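(* Let $K=\mathbb{F}_q$ be a finite field. Let $\mathcal{G}$ be a bipartite simple graph on vertices $v_1,\ldots,v_{2k}$ with $s$ edges, every edge joining a vertex of $\{v_1,v_3,\ldots,v_{2k-1}\}$ to a vertex of $\{v_2,v_4,\ldots,v_{2k}\}$, and having the perfect matching $\{\{v_{2i-1},v_{2i}\}: i=1,\ldots,k\}$. Let $n_i=\deg v_i$, so $n_1+n_3+\cdots+n_{2k-1}=s$. Let $$\mathbb{Y}=\{[t_1,\ldots,t_1,t_3,\ldots,t_3,\ldots,t_{2k-1},\ldots,t_{2k-1}]\in\mathbb{P}^{s-1}: t_i\in K^*\},$$ where $t_i$ appears $n_i$ times for each $i=1,3,\ldots,2k-1$. Put $a_1=1$ and $a_j=n_1+n_3+\cdots+n_{2j-3}+1$ for $j=2,\ldots,k$ (so $a_j$ is the first index of the $j$-th block of coordinates). Then $\mathbb{Y}$ is a complete intersection. In fact, the vanishing ideal $I_{\mathbb{Y}}\subseteq S=K[X_1,\ldots,X_s]$ is generated by the union $\mathbb{W}_0\cup\mathbb{W}_1\cup\mathbb{W}_3\cup\cdots\cup\mathbb{W}_{2k-1}$ of the sets $$\mathbb{W}_0=\{X_{a_j}^{q-1}-X_1^{q-1}: j=2,\ldots,k\},$$ $$\mathbb{W}_{2j-1}=\{X_i-X_{a_j}: a_j+1\le i\le a_j+n_{2j-1}-1\},\qquad j=1,\ldots,k,$$ where $\mathbb{W}_{2j-1}=\emptyset$ if $n_{2j-1}=1$.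
   Context: $K^*=K\setminus\{0\}$ and $\mathbb{P}^{s-1}$ is the projective space over $K$. The vanishing ideal $I_{\mathbb{Y}}$ of a set $\mathbb{Y}\subseteq\mathbb{P}^{s-1}$ is the ideal of $S=K[X_1,\ldots,X_s]$ generated by the homogeneous polynomials vanishing at all points of $\mathbb{Y}$. A set $\mathbb{Y}\subseteq\mathbb{P}^{s-1}$ is called a complete intersection if $I_{\mathbb{Y}}$ is generated by a regular sequence of $s-1$ elements, i.e. $I_{\mathbb{Y}}=(f_1,\ldots,f_{s-1})$ where $f_1$ is not a zero divisor of $S$ and $f_i$ is not a zero divisor of $S/(f_1,\ldots,f_{i-1})$ for $i=2,\ldots,s-1$. *)

(* Defs.v *)
From HB Require Import structures.
From mathcomp Require Import all_boot all_order all_algebra.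
From mathcomp Require Import mpoly.

Set Implicit Arguments.
Unset Strict Implicit.
Unset Printing Implicit Defensive.

Import Order.TTheory GRing.Theory.
Local Open Scope ring_scope.

Section Ideals.
Variable S : comNzRingType.
Implicit Types (W : S -> Prop) (fs : seq S).

Definition ideal_gen W (f : S) : Prop :=
  exists (m : nat) (c g : 'I_m -> S),
    (forall i, W (g i)) /\ f = \sum_(i < m) c i * g i.

(* ideal_gen [::] is the zero ideal. *)
Definition ideal_seq fs : S -> Prop := ideal_gen (fun f => f \in fs).

(* "f is not a zero divisor of S / I", written without forming the quotient. *)
Definition nonzerodiv_mod (I : S -> Prop) (f : S) : Prop :=
  forall g, I (f * g) -> I g.

(* No properness of the generated ideal is required. *)
Definition regular_seq fs : Prop :=
  forall i, (i < size fs)%N -> nonzerodiv_mod (ideal_seq (take i fs)) fs`_i.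

End Ideals.

Section Projective.
Variables (K : fieldType) (s : nat).

(* P^(s-1), as the set of lines of K^s. *)
Definition proj_space := {L : {vspace 'rV[K]_s} | \dim L == 1%N}.

(* P = [v]; in particular v is nonzero. *)
Definition proj_coords (P : proj_space) (v : 'rV[K]_s) : Prop :=
  val P = <[v]>%VS.

Definition vanishes_at (f : {mpoly K[s]}) (P : proj_space) : Prop :=
  forall v, proj_coords P v -> f.@[v 0] = 0.

Definition homogeneous (f : {mpoly K[s]}) : Prop :=
  exists d : nat, f \is d.-homog.

Definition vanishing_ideal (Y : proj_space -> Prop) : {mpoly K[s]} -> Prop :=
  ideal_gen (fun f => homogeneous f /\ forall P, Y P -> vanishes_at f P).

Definition complete_intersection (Y : proj_space -> Prop) : Prop :=
  exists fs : (s.-1).-tuple {mpoly K[s]},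
    (forall f, vanishing_ideal Y f <-> ideal_seq fs f) /\ regular_seq fs.

End Projective.

Section Graphs.
Variables (V : finType) (e : rel V).

Definition edges : {set {set V}} :=
  [set [set p.1; p.2] | p : V * V & e p.1 p.2].

Definition deg (x : V) : nat := #|[set y | e x y]|.

Definition perfect_matching (M : {set {set V}}) : bool :=
  (M \subset edges) && partition M [set: V].

End Graphs.

Section Blocks.
Variable k : nat.

Lemma left_vertex_subproof (j : 'I_k) : (j.*2 < k.*2)%N.
Proof. by rewrite ltn_double. Qed.

Lemma right_vertex_subproof (j : 'I_k) : (j.*2.+1 < k.*2)%N.
Proof. by rewrite ltn_Sdouble. Qed.

(* The vertex v_m is the ordinal m - 1 of 'I_k.*2, so for j = 0, ..., k - 1 the
   following are v_(2j+1) and v_(2j+2); the odd-labelled vertices are the even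
   ordinals. *)
Definition left_vertex (j : 'I_k) : 'I_k.*2 :=
  Ordinal (left_vertex_subproof j).
Definition right_vertex (j : 'I_k) : 'I_k.*2 :=
  Ordinal (right_vertex_subproof j).

Definition standard_matching : {set {set 'I_k.*2}} :=
  [set [set left_vertex j; right_vertex j] | j : 'I_k].

Variables (K : finFieldType) (s : nat) (n : 'I_k -> nat).

(* The family n is indexed from 0: n j is the degree n_(2j+1) of v_(2j+1), and
   coordinates X_1, ..., X_s are 'X_0, ..., 'X_(s-1), so that
   block_start j = a_(j+1) - 1. *)
Definition block_start (j : 'I_k) : nat := \sum_(l < k | (l < j)%N) n l.

(* (t_1, ..., t_1, t_3, ..., t_3, ...), with t j repeated n j times. *)
Definition block_row (t : 'I_k -> K) : 'rV[K]_s :=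
  \row_(i < s) (flatten [seq nseq (n j) (t j) | j <- enum 'I_k])`_i.

Definition block_torus (P : proj_space K s) : Prop :=
  exists t : 'I_k -> K, (forall j, t j != 0) /\ proj_coords P (block_row t).

Definition W0 (f : {mpoly K[s]}) : Prop :=
  exists (j : 'I_k) (x y : 'I_s),
    [/\ (0 < j)%N, x = block_start j :> nat, y = 0%N :> nat
      & f = 'X_x ^+ (#|K| - 1) - 'X_y ^+ (#|K| - 1)].

(* The set W_(2j+1). *)
Definition Wblock (j : 'I_k) (f : {mpoly K[s]}) : Prop :=
  exists i x : 'I_s,
    [/\ x = block_start j :> nat, (block_start j < i < block_start j + n j)%N
      & f = 'X_i - 'X_x].

End Blocks.

(* Main.v *)
(* The generators are, for each index i > 0, a difference of powers
   f_i = X_i^d - X_p^d with p < i: d = q - 1 and p is the first index if i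
   starts a block, d = 1 and p is the start of the block of i otherwise.
   As f_i is monic in X_i while the earlier f_j do not involve X_i, the f_i form
   a regular sequence. Modulo the f_i every monomial is congruent to one of the
   same degree whose exponent at each i > 0 is less than d, so a homogeneous f
   vanishing on Y is congruent to a homogeneous r which vanishes on the torus
   and has degree < q - 1 in all variables but the first; character sums over
   K^* extract the coefficients of r and show that r = 0. *)
Require Import Defs.
From HB Require Import structures.
From mathcomp Require Import all_boot all_order all_algebra all_field.
From mathcomp Require Import mpoly.

Set Implicit Arguments.
Unset Strict Implicit.
Unset Printing Implicit Defensive.

Import Order.TTheory GRing.Theory.
Local Open Scope ring_scope.

(** * Generated ideals, and cancelling a monic polynomial coefficientwise *)

Section IdealGen.
Variable S : comNzRingType.
Implicit Types (W : S -> Prop) (f g : S).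

Lemma ideal_gen_mem W f : W f -> ideal_gen W f.
Proof.
move=> Wf; exists 1, (fun=> 1), (fun=> f).
by split=> //; rewrite big_ord1 mul1r.
Qed.

Lemma ideal_gen0 W : ideal_gen W 0.
Proof.
exists 0, (fun=> 0), (fun=> 0); split; last by rewrite big_ord0.
by case.
Qed.

Lemma ideal_genD W f g : ideal_gen W f -> ideal_gen W g -> ideal_gen W (f + g).
Proof.
move=> [m [c [u [Wu ->]]]] [m' [c' [u' [Wu' ->]]]].
exists (m + m')%N, (fun i => match split i with inl j => c j | inr j => c' j end),
  (fun i => match split i with inl j => u j | inr j => u' j end).
split; first by move=> i; case: (split i).
rewrite big_split_ord /=; congr (_ + _); apply: eq_bigr => i _.
  by rewrite (unsplitK (inl i)).
by rewrite (unsplitK (inr i)).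
Qed.

Lemma ideal_genMl W f g : ideal_gen W g -> ideal_gen W (f * g).
Proof.
move=> [m [c [u [Wu ->]]]]; exists m, (fun i => f * c i), u; split=> //.
by rewrite mulr_sumr; apply: eq_bigr => i _; rewrite mulrA.
Qed.

Lemma ideal_genB W f g : ideal_gen W f -> ideal_gen W g -> ideal_gen W (f - g).
Proof. by move=> If Ig; rewrite -mulN1r; apply/ideal_genD/ideal_genMl. Qed.

Lemma ideal_gen_sum W (I : eqType) (r : seq I) (F : I -> S) :
  (forall i, i \in r -> ideal_gen W (F i)) -> ideal_gen W (\sum_(i <- r) F i).
Proof.
move=> IF; rewrite big_seq; apply: (big_ind (ideal_gen W)) => //.
  exact: ideal_gen0.
exact: ideal_genD.
Qed.

Lemma ideal_gen_sub W W' f :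
  (forall g, W g -> ideal_gen W' g) -> ideal_gen W f -> ideal_gen W' f.
Proof.
move=> WW' [m [c [u [Wu ->]]]]; apply: ideal_gen_sum => i _.
exact/ideal_genMl/WW'/Wu.
Qed.

Lemma ideal_gen_eq W W' f :
  (forall g, W g <-> W' g) -> ideal_gen W f <-> ideal_gen W' f.
Proof.
by move=> WW'; split; apply: ideal_gen_sub => g /WW'/ideal_gen_mem.
Qed.

(* The coefficients of G are recovered from the top one down. *)
Lemma ideal_gen_coef_monicM W (F G : {poly S}) :
    F \is monic -> (forall m, ideal_gen W (F * G)`_m) ->
  forall m, ideal_gen W G`_m.
Proof.
move=> F_monic FGW m; have F_neq0 := monic_neq0 F_monic.
have [b] := ubnP (size G - m)%N; elim: b m => // b IHb m.
have [le_G_m _|lt_m_G ltb] := leqP (size G) m.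
  by rewrite nth_default //; apply: ideal_gen0.
(* As [F] is monic of degree [d], the coefficient of [F * G] at [m + d] is that of [G] at [m], plus
   terms in which [G] enters with an index above [m]. *)
set d := (size F).-1; have := FGW (m + d)%N; rewrite coefM.
have ltd : (d < (m + d).+1)%N by rewrite ltnS leq_addl.
rewrite (bigD1 (Ordinal ltd)) //= addnK -[F`_d]/(lead_coef F).
rewrite (monicP F_monic) mul1r.
set T := \sum_(j < _ | _) _ => ID.
suff IT : ideal_gen W T by rewrite -[G`_m](addrK T); apply: ideal_genB.
rewrite /T big_mkcond; apply: ideal_gen_sum => j _.
case: ifP => [neq_j|_]; last exact: ideal_gen0.
have [le_F_j|lt_j_F] := leqP (size F) j.
  by rewrite [F`_j]nth_default // mul0r; apply: ideal_gen0.
have lt_j_d : (j < d)%N.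
  rewrite ltn_neqAle; rewrite -val_eqE /= in neq_j.
  by rewrite neq_j -ltnS /d prednK // size_poly_gt0.
apply/ideal_genMl/IHb; rewrite -addnBA; last exact: ltnW.
apply: (leq_trans _ (ltnSE ltb)); rewrite ltn_sub2l //.
by rewrite -[X in (X < _)%N]addn0 ltn_add2l subn_gt0.
Qed.

End IdealGen.

(** * Multivariate polynomials as univariate polynomials in a chosen variable *)

Lemma horner_mmap n (R : nzRingType) (S : comNzRingType) (a : {rmorphism R -> S})
    (h : 'I_n -> {poly S}) (x : S) (f : {mpoly R[n]}) :
  (mmap (polyC \o a) h f).[x] = mmap a (fun j => (h j).[x]) f.
Proof.
rewrite /mmap horner_sum; apply: eq_bigr => m _.
rewrite hornerM hornerC /mmap1 horner_prod; congr (_ * _).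
by apply: eq_bigr => j _; rewrite horner_exp.
Qed.

Section MainVariable.
Variables (n : nat) (R : comNzRingType) (i : 'I_n).

(** The coefficients stay in the full ring [{mpoly R[n]}], so that evaluation at ['X_i] recovers the
    polynomial; [split_var g = g%:P] then expresses that [g] is free of ['X_i]. *)
Definition split_var : {mpoly R[n]} -> {poly {mpoly R[n]}} :=
  mmap (polyC \o @mpolyC n R) (fun j => if j == i then 'X else ('X_j)%:P).

HB.instance Definition _ := GRing.RMorphism.on split_var.

Lemma split_varX : split_var 'X_i = 'X.
Proof. by rewrite /split_var mmapX mmap1U eqxx. Qed.

Lemma split_var_other j : j != i -> split_var 'X_j = ('X_j)%:P.
Proof. by rewrite /split_var mmapX mmap1U => /negPf->. Qed.

Lemma horner_split_var f : (split_var f).['X_i] = f.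
Proof.
rewrite /split_var horner_mmap [RHS]mpolyE /mmap; apply: eq_bigr => m _.
rewrite mul_mpolyC -[in RHS]mmap1_id; congr (_ *: _); apply: mmap1_eq => j.
by case: eqP => [->|_]; rewrite ?hornerX ?hornerC.
Qed.

(** Generators free of ['X_i] become constants, so the coefficients of a combination of them are
    again such combinations. *)
Lemma ideal_gen_split_var (W : {mpoly R[n]} -> Prop) f m :
    (forall g, W g -> split_var g = g%:P) ->
  ideal_gen W f -> ideal_gen W (split_var f)`_m.
Proof.
move=> Wfree [l [c [u [Wu ->]]]].
rewrite rmorph_sum coef_sum; apply: ideal_gen_sum => j _.
rewrite rmorphM /= (Wfree _ (Wu j)) coefMC.
by apply/ideal_genMl/ideal_gen_mem/Wu.
Qed.

(** When the generators are free of ['X_i], membership can be tested on the coefficients in ['X_i],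
    where [ideal_gen_coef_monicM] cancels the monic factor. *)
Lemma monic_nonzerodiv_mod (W : {mpoly R[n]} -> Prop) f :
    (forall g, W g -> split_var g = g%:P) -> split_var f \is monic ->
  nonzerodiv_mod (ideal_gen W) f.
Proof.
move=> Wfree f_monic g fgW.
rewrite -[g]horner_split_var horner_coef; apply: ideal_gen_sum => m _.
rewrite mulrC; apply: ideal_genMl; move: m (val m) => _.
apply: (ideal_gen_coef_monicM f_monic) => m.
by rewrite -rmorphM; apply: ideal_gen_split_var.
Qed.

End MainVariable.

(** * Regularity of, and reduction modulo, differences of powers of two variables *)

Section PowerDifferences.
Variables (s : nat) (R : comNzRingType).
Variables (p : 'I_s.+1 -> 'I_s.+1) (d : 'I_s.+1 -> nat).
Hypothesis p_lt : forall i, i != ord0 -> (p i < i)%N.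

Definition power_diff i : {mpoly R[s.+1]} := 'X_i ^+ d i - 'X_(p i) ^+ d i.

(** The index increases along the sequence, so that under [p_lt] no member before [power_diff i]
    involves ['X_i]. *)
Definition power_diff_seq : s.-tuple {mpoly R[s.+1]} :=
  [tuple power_diff (lift ord0 j) | j < s].

Definition power_diffs f := exists2 i, i != ord0 & f = power_diff i.

Lemma nth_power_diff_seq (j : 'I_s) :
  power_diff_seq`_j = power_diff (lift ord0 j).
Proof. by rewrite -tnth_nth tnth_mktuple. Qed.

Lemma ideal_seq_power_diffs f :
  ideal_seq power_diff_seq f <-> ideal_gen power_diffs f.
Proof.
apply: ideal_gen_eq => g; split=> [/mapP[j _ ->]|[i i_neq0 ->]].
  by exists (lift ord0 j) => //; rewrite eq_sym neq_lift.
have [j -> | eq_i] := unliftP ord0 i; last by rewrite eq_i eqxx in i_neq0.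
by apply/mapP; exists j; rewrite ?mem_enum.
Qed.

Hypothesis d_gt0 : forall i, (0 < d i)%N.

Lemma split_var_power_diff_monic i :
  i != ord0 -> split_var i (power_diff i) \is monic.
Proof.
move=> i_neq0; have p_neq : p i != i by rewrite -val_eqE ltn_eqF ?p_lt.
rewrite rmorphB !rmorphXn /= split_varX split_var_other // -polyC_exp.
by rewrite monicXnsubC.
Qed.

Lemma power_diff_seq_regular : regular_seq power_diff_seq.
Proof.
move=> m; rewrite size_tuple => lt_m_s; pose j := Ordinal lt_m_s.
rewrite -[m]/(val j) nth_power_diff_seq.
have j_neq0 : lift ord0 j != ord0 by rewrite eq_sym neq_lift.
apply: monic_nonzerodiv_mod (split_var_power_diff_monic j_neq0) => g.
case/(nthP 0) => l; rewrite size_takel ?size_tuple; last exact: ltnW.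
move=> lt_l_j.
have lt_l_s := ltn_trans lt_l_j (ltn_ord j).
rewrite nth_take // -[l]/(val (Ordinal lt_l_s)) nth_power_diff_seq => <-.
set i := lift ord0 (Ordinal lt_l_s).
have lt_ij : (i < lift ord0 j)%N by rewrite /i !lift0.
have i_neq0 : i != ord0 by rewrite eq_sym neq_lift.
rewrite rmorphB !rmorphXn /= !split_var_other -?val_eqE ?ltn_eqF //.
  by rewrite -!polyC_exp -polyCB.
exact: ltn_trans (p_lt i_neq0) lt_ij.
Qed.

(** The exponent at [ord0] stays free because no generator rewrites that variable. *)
Definition reduced (r : {mpoly R[s.+1]}) :=
  forall (m : 'X_{1..s.+1}) i, m \in msupp r -> i != ord0 -> (m i < d i)%N.

(* Rewriting X_i^(d i) into X_(p i)^(d i) lowers \sum_i i * m_i. *)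
Lemma mpolyX_reduce (m : 'X_{1..s.+1}) :
  exists2 m' : 'X_{1..s.+1},
    mdeg m' = mdeg m /\ (forall i, i != ord0 -> (m' i < d i)%N)
    & ideal_gen power_diffs ('X_[m] - 'X_[m']).
Proof.
have [b] := ubnP (\sum_(i < s.+1) i * m i)%N; elim: b m => // b IHb m ltb.
case: (pickP [pred i | (i != ord0) && (d i <= m i)%N]) => /= [i|no_i]; last first.
  exists m; last by rewrite subrr; apply: ideal_gen0.
  by split=> // i i_neq0; have:= no_i i; rewrite /= i_neq0 ltnNge /= => ->.
case/andP=> i_neq0 le_di.
have le_m : (U_(i) *+ d i <= m)%MM.
  apply/mnm_lepP => j; rewrite mulmnE mnm1E.
  by case: eqP => [<-|_]; rewrite ?mul1n.
(* Moving [d i] units of exponent from [i] to [p i] keeps the degree and lowers the weight by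
   [(i - p i) * d i]. *)
pose m0 := (m - U_(i) *+ d i)%MM; pose m1 := (m0 + U_(p i) *+ d i)%MM.
have def_m : m = (m0 + U_(i) *+ d i)%MM by rewrite submK.
have deg1 : mdeg m1 = mdeg m by rewrite def_m !mdegD !mdegMn !mdeg1.
have weight_U (j : 'I_s.+1) : (\sum_(l < s.+1) l * (U_(j) *+ d i)%MM l = j * d i)%N.
  rewrite (bigD1 j) //= mulmnE mnm1E eqxx mul1n big1 ?addn0 // => l.
  by rewrite mulmnE mnm1E eq_sym => /negPf->; rewrite mul0n muln0.
have weightD (u v : 'X_{1..s.+1}) :
    (\sum_(l < s.+1) l * (u + v)%MM l
       = \sum_(l < s.+1) l * u l + \sum_(l < s.+1) l * v l)%N.
  by rewrite -big_split; apply: eq_bigr => l _; rewrite mnmDE mulnDr.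
have lt1 : (\sum_(j < s.+1) j * m1 j < \sum_(j < s.+1) j * m j)%N.
  by rewrite def_m /m1 !weightD ltn_add2l !weight_U ltn_pmul2r ?p_lt.
have [m' [deg' red'] I'] := IHb m1 (leq_trans lt1 ltb).
exists m'; first by rewrite deg' deg1.
(* Split at ['X_[m1]]: the first difference is ['X_[m0]] times [power_diff i], the second is in the
   ideal by induction. *)
rewrite -['X_[m]](subrK 'X_[m1]) -addrA; apply: ideal_genD => //.
rewrite def_m !mpolyXD -!mpolyXn -mulrBr.
by apply/ideal_genMl/ideal_gen_mem; exists i.
Qed.

Lemma homog_reduce f l : f \is l.-homog ->
  exists r, [/\ r \is l.-homog, reduced r & ideal_gen power_diffs (f - r)].
Proof.
move/dhomogP=> deg_f; rewrite [f]mpolyE.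
(* Only the list of monomials is generalized; the coefficients remain those of [f]. *)
elim: (msupp f) deg_f => [|m ms IHms] deg_f.
  exists 0; split; first exact: dhomog0.
    by move=> m i; rewrite msupp0.
  by rewrite big_nil subrr; apply: ideal_gen0.
have [|r [r_hom r_red Ir]] := IHms.
  by move=> u ms_u; apply: deg_f; rewrite inE ms_u orbT.
have [m' [deg_m' red_m'] Im] := mpolyX_reduce m.
exists (f@_m *: 'X_[m'] + r); split.
- by rewrite dhomogD ?dhomogZ // dhomogX /= deg_m' deg_f ?mem_head.
- move=> u i /msuppD_le; rewrite mem_cat => /orP[/msuppZ_le|/r_red]; last exact.
  by rewrite msuppX inE => /eqP->; apply: red_m'.
- rewrite big_cons opprD addrACA; apply: ideal_genD => //.
  by rewrite -scalerBr -mul_mpolyC; apply: ideal_genMl.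
Qed.

End PowerDifferences.

(** * Power sums over $K^*$ and polynomials vanishing on the torus *)

Section TorusSums.
Variable K : finFieldType.

Lemma card_pred_gt0 : (0 < #|K| - 1)%N.
Proof. by rewrite subn_gt0 finNzRing_gt1. Qed.

Lemma expf_card_pred (x : K) : x != 0 -> x ^+ (#|K| - 1) = 1.
Proof.
move=> x_neq0; apply: (mulfI x_neq0).
by rewrite -exprS mulr1 -addn1 subnK ?expf_card // ltnW ?finNzRing_gt1.
Qed.

(** Every term is 1, and the $q-1$ of them add up to $-1$ because $q=0$ in $K$. *)
Lemma sum_torus_expr_dvd e :
  (#|K| - 1 %| e)%N -> \sum_(x : K | x != 0) x ^+ e = -1.
Proof.
case/dvdnP=> c ->; rewrite (eq_bigr (fun=> 1)); last first.
  by move=> x x_neq0; rewrite mulnC exprM expf_card_pred ?expr1n.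
(* The translation by 1 permutes $K$, so the sums of [x] and of [x + 1] agree. *)
have sum1 : \sum_(x : K) (1 : K) = 0.
  apply: (addrI (\sum_(x : K) x)); rewrite -big_split addr0.
  by rewrite [RHS](reindex_inj (addIr 1)).
by apply/eqP; rewrite -addr_eq0 addrC -[X in _ == X]sum1 [eqbRHS](bigD1 0).
Qed.

(** Multiplication by [a] permutes $K^*$, so the sum is fixed by the factor [a ^+ e]. Some [a] has
    [a ^+ e != 1]: otherwise $X^r-1$, with $r$ the nonzero remainder of $e$ modulo $q-1$, would have
    $q-1>r$ roots. *)
Lemma sum_torus_expr_ndvd e :
  ~~ (#|K| - 1 %| e)%N -> \sum_(x : K | x != 0) x ^+ e = 0.
Proof.
move=> ndvd_e; set r := (e %% (#|K| - 1))%N.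
have r_gt0 : (0 < r)%N by rewrite lt0n.
have expr_e (x : K) : x != 0 -> x ^+ e = x ^+ r.
  move=> x_neq0; rewrite {1}(divn_eq e (#|K| - 1)) exprD mulnC exprM.
  by rewrite expf_card_pred // expr1n mul1r.
have [a a_neq0 ae_neq1] : exists2 a : K, a != 0 & a ^+ e != 1.
  case: (pickP [pred a : K | (a != 0) && (a ^+ e != 1)]) => [a /andP[]|no_a].
    by exists a.
  have size_P := size_XnsubC (1 : K) r_gt0.
  have root_P : all (root ('X^r - 1%:P)) (enum [pred a : K | a != 0]).
    apply/allP=> a; rewrite mem_enum inE => a_neq0.
    have /negbT := no_a a; rewrite /= a_neq0 negbK expr_e // => /eqP ar.
    by rewrite rootE !hornerE ar subrr.
  have := max_poly_roots _ root_P (enum_uniq _).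
  rewrite -size_poly_gt0 size_P -cardE => /(_ isT).
  by rewrite ltnS (cardC1 (0 : K)) -subn1 leqNgt ltn_mod card_pred_gt0.
set S := \sum_(x | _) _; have : a ^+ e * S = S.
  rewrite mulr_sumr [RHS](reindex_inj (mulfI a_neq0)) /=.
  apply: eq_big => x; first by rewrite mulf_eq0 (negPf a_neq0).
  by rewrite exprMn.
move/eqP; rewrite -subr_eq0 -{2}[S]mul1r -mulrBl mulf_eq0 subr_eq0.
by rewrite (negPf ae_neq1) => /eqP.
Qed.

(* The coefficient of X^m0 is extracted by summing t^(-m0) r(t) over the torus
   points with t_0 = 1. *)
Lemma torus_eq0 s l (r : {mpoly K[s.+1]}) :
    r \is l.-homog ->
    (forall (m : 'X_{1..s.+1}) i,
       m \in msupp r -> i != ord0 -> (m i < #|K| - 1)%N) ->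
    (forall t : 'I_s.+1 -> K, (forall i, t i != 0) -> r.@[t] = 0) ->
  r = 0.
Proof.
move/dhomogP=> r_hom r_red r_van; apply/eqP; rewrite -msupp_eq0.
case def_supp: (msupp r) => [//|m0 ms]; exfalso.
have supp_m0 : m0 \in msupp r by rewrite def_supp mem_head.
pose Q (i : 'I_s.+1) := [pred x : K | if i == ord0 then x == 1 else x != 0].
(* Since $x^{q-1}=1$ on $K^*$, the exponent [#|K| - 1 - m0 i] acts as [- m0 i]. At [ord0] the
   coordinate is 1. *)
pose w (i : 'I_s.+1) := (if i == ord0 then 0 else #|K| - 1 - m0 i)%N.
pose c (m : 'X_{1..s.+1}) := \prod_i \sum_(x | Q i x) x ^+ (w i + m i).
have Q_neq0 i x : Q i x -> x != 0.
  by rewrite /=; case: ifP => _ // /eqP->; apply: oner_neq0.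
have sum0 : \sum_(m <- msupp r) r@_m * c m = 0.
  (* Expanding the product of sums, [c m] is the sum over all [t] in the family of the monomial with
     exponents [w i + m i]. *)
  transitivity (\sum_(t in family Q) (\prod_i t i ^+ w i) * r.@[t]).
    under [RHS]eq_bigr do rewrite mevalE mulr_sumr.
    rewrite exchange_big; apply: eq_bigr => m _ /=.
    rewrite /c bigA_distr_big_dep mulr_sumr; apply: eq_bigr => t _.
    rewrite mulrCA -big_split; congr (_ * _); apply: eq_bigr => i _.
    by rewrite exprD.
  apply: big1 => t /familyP Qt; rewrite r_van ?mulr0 // => i.
  exact: Q_neq0 (Qt i).
have c0 m : m \in msupp r -> m != m0 -> c m = 0.
  move=> supp_m neq_m; apply/eqP/prodf_eq0.
  (* Both monomials have degree [l], so they cannot differ at [ord0] alone. *)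
  have [i i_neq0 neq_i] : exists2 i, i != ord0 & m i != m0 i.
    case: (pickP [pred i | (i != ord0) && (m i != m0 i)]) => [i /andP[]|no_i].
      by exists i.
    have eq_i i : i != ord0 -> m i = m0 i.
      by move=> i_neq0; have:= no_i i; rewrite /= i_neq0 /= => /negbFE/eqP.
    case/eqP: neq_m; apply/mnmP => i; have [->|/eq_i//] := eqVneq i ord0.
    have := r_hom _ supp_m; rewrite -(r_hom _ supp_m0) /= !mdegE.
    rewrite (bigD1 ord0) //= [RHS](bigD1 ord0) //= (eq_bigr _ eq_i).
    exact: addIn.
  exists i => //; rewrite (eq_bigl (fun x => x != 0)) => [|x]; last first.
    by rewrite /= (negPf i_neq0).
  have lt_m := r_red _ _ supp_m i_neq0; have lt_m0 := r_red _ _ supp_m0 i_neq0.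
  rewrite sum_torus_expr_ndvd // /w (negPf i_neq0).
  apply: contra neq_i => dvd_i.
  (* Divisibility would make [m i] and [m0 i] congruent modulo $q-1$, hence equal, as both are
     smaller. *)
  have : (#|K| - 1 - m0 i + m i + m0 i = m0 i %[mod #|K| - 1])%N.
    by rewrite -modnDml (eqP dvd_i).
  by rewrite addnAC subnK ?(ltnW lt_m0) // modnDl !modn_small // => ->.
have cm0 : c m0 != 0.
  apply/prodf_neq0 => i _; rewrite /w /Q /=; have [->|i_neq0] := eqVneq i ord0.
    by rewrite big_pred1_eq expr1n oner_neq0.
  rewrite sum_torus_expr_dvd ?oppr_eq0 ?oner_neq0 //.
  by rewrite subnK ?(ltnW (r_red _ _ supp_m0 i_neq0)).
move/eqP: sum0; rewrite (bigD1_seq m0) ?msupp_uniq //= big_seq_cond.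
rewrite big1 => [|m /andP[supp_m neq_m]]; last by rewrite c0 ?mulr0.
by rewrite addr0 mulf_eq0 (negPf cm0) orbF mcoeff_eq0 supp_m0.
Qed.

End TorusSums.

(** * The correspondence between coordinates and blocks *)

Section BlockIndex.
Variables (k : nat) (n : 'I_k -> nat).

Let block_sizes := [seq n j | j <- enum 'I_k].

(** The entries of [block_row] are the images under [t] of these labels, which makes the block of a
    coordinate available independently of [t]. *)
Definition block_labels : seq 'I_k := flatten [seq nseq (n j) j | j <- enum 'I_k].

Lemma shape_block_labels : shape [seq nseq (n j) j | j <- enum 'I_k] = block_sizes.
Proof. by rewrite /shape -map_comp; apply: eq_map => j /=; rewrite size_nseq. Qed.

Lemma sumn_block_sizes : sumn block_sizes = (\sum_j n j)%N.
Proof. by rewrite sumnE big_map big_enum. Qed.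

Lemma size_block_labels : size block_labels = (\sum_j n j)%N.
Proof. by rewrite size_flatten shape_block_labels sumn_block_sizes. Qed.

Lemma nth_block_sizes (j : 'I_k) : nth 0%N block_sizes j = n j.
Proof. by rewrite (nth_map j) ?size_enum_ord // nth_ord_enum. Qed.

Lemma block_startE (j : 'I_k) : block_start n j = sumn (take j block_sizes).
Proof.
rewrite /block_start (eq_bigr (fun l : 'I_k => nth 0%N block_sizes l)); last first.
  by move=> l _; rewrite nth_block_sizes.
rewrite -(big_ord_widen _ (fun l => nth 0%N block_sizes l)) 1?ltnW //.
have size_j : size (take j block_sizes) = j.
  by rewrite size_takel // size_map size_enum_ord ltnW.
rewrite sumnE (big_nth 0%N) size_j big_mkord; apply: eq_bigr => l _.
by rewrite nth_take.
Qed.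

Lemma nth_block_labelsP j0 i (j := nth j0 block_labels i) :
  (i < \sum_l n l)%N -> (block_start n j <= i < block_start n j + n j)%N.
Proof.
rewrite -sumn_block_sizes => lt_i.
(* The block of [i] is its [reshape_index] for the block sizes, and its position inside the block is
   the [reshape_offset]. *)
have lt_r := reshape_indexP lt_i; rewrite size_map size_enum_ord in lt_r.
have := reshape_offsetP lt_i.
rewrite -[X in nth 0%N _ X]/(val (Ordinal lt_r)) nth_block_sizes => lt_off.
have -> : j = Ordinal lt_r.
  rewrite /j nth_flatten shape_block_labels.
  rewrite (nth_map j0) ?size_enum_ord // nth_nseq.
  rewrite -[X in nth _ _ X]/(val (Ordinal lt_r)) nth_ord_enum.
  by rewrite lt_off.
rewrite -{2 3}[i](reshape_indexK block_sizes) /flatten_index block_startE.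
by rewrite leq_addr ltn_add2l.
Qed.

Lemma nth_block_labels j0 i (j : 'I_k) :
  (block_start n j <= i < block_start n j + n j)%N -> nth j0 block_labels i = j.
Proof.
case/andP=> le_i lt_i; rewrite -(subnKC le_i) block_startE.
set c := (i - _)%N; have lt_c : (c < nth 0%N block_sizes j)%N.
  by rewrite nth_block_sizes /c ltn_subLR // -block_startE.
rewrite nth_flatten shape_block_labels -/(flatten_index _ _ _).
rewrite flatten_indexKl // flatten_indexKr // (nth_map j) ?size_enum_ord //.
by rewrite nth_ord_enum nth_nseq -nth_block_sizes lt_c.
Qed.

Lemma block_rowE (K : finFieldType) s (t : 'I_k -> K) j0 (i : 'I_s) :
  (i < \sum_j n j)%N -> block_row s n t 0 i = t (nth j0 block_labels i).
Proof.
rewrite -size_block_labels => lt_i; rewrite mxE -(nth_map _ 0) //.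
rewrite map_flatten -map_comp; congr (flatten _)`_i.
by apply: eq_map => j /=; rewrite map_nseq.
Qed.

End BlockIndex.

(** * The vanishing ideal of the block torus *)

Section BlockTorus.
Variables (K : finFieldType) (k s : nat) (n : 'I_k -> nat).
Hypotheses (n_gt0 : forall j, (0 < n j)%N) (sum_n : (\sum_j n j)%N = s.+1).

Lemma blocks_gt0 : (0 < k)%N.
Proof. by case: k n sum_n => // n0; rewrite big_ord0. Qed.

Let j0 := Ordinal blocks_gt0.

Definition block (i : 'I_s.+1) : 'I_k := nth j0 (block_labels n) i.
Definition start (j : 'I_k) : 'I_s.+1 := inord (block_start n j).

Definition parent i := if i == start (block i) then ord0 else start (block i).
Definition expo i := if i == start (block i) then (#|K| - 1)%N else 1%N.

Lemma blockP i :
  (block_start n (block i) <= i < block_start n (block i) + n (block i))%N.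
Proof. by apply: nth_block_labelsP; rewrite sum_n. Qed.

Lemma block_eq (i : 'I_s.+1) j :
  (block_start n j <= i < block_start n j + n j)%N -> block i = j.
Proof. exact: nth_block_labels. Qed.

(** Block [j] is itself nonempty, so the earlier blocks do not exhaust the coordinates; hence
    [inord] in [start] never takes its default value. *)
Lemma block_start_lt j : (block_start n j < s.+1)%N.
Proof.
rewrite -sum_n /block_start [X in (_ < X)%N](bigID (fun l : 'I_k => (l < j)%N)) /=.
rewrite -[X in (X < _)%N]addn0 ltn_add2l (bigD1 j) ?ltnn //=.
by rewrite addn_gt0 n_gt0.
Qed.

Lemma startE j : start j = block_start n j :> nat.
Proof. by rewrite inordK ?block_start_lt. Qed.

Lemma block_startK j : block (start j) = j.
Proof.
by apply: block_eq; rewrite startE leqnn -[X in (X < _)%N]addn0 ltn_add2l n_gt0.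
Qed.

Lemma start_block_le i : (start (block i) <= i)%N.
Proof. by rewrite startE; case/andP: (blockP i). Qed.

Lemma block_start_gt0 (j : 'I_k) : (0 < j)%N -> (0 < block_start n j)%N.
Proof.
by move=> j_gt0; rewrite /block_start (bigD1 j0) //= addn_gt0 n_gt0.
Qed.

Lemma parent_lt i : i != ord0 -> (parent i < i)%N.
Proof.
move=> i_neq0; rewrite /parent; case: eqP => [_|neq_i]; first by rewrite lt0n.
rewrite ltn_neqAle start_block_le andbT eq_sym val_eqE.
exact/eqP.
Qed.

Lemma expo_gt0 i : (0 < expo i)%N.
Proof. by rewrite /expo; case: ifP; rewrite ?card_pred_gt0. Qed.

Lemma start_blockP i :
  i != start (block i) -> (block_start n (block i) < i)%N.
Proof.
by move=> neq_i; rewrite -startE ltn_neqAle start_block_le eq_sym val_eqE neq_i.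
Qed.

Let B := power_diffs parent expo (R := K).

Lemma power_diffs_blocks f :
  B f <-> W0 n f \/ exists j, Wblock n j f.
Proof.
split=> [[i i_neq0 ->]|[[j [x [y [j_gt0 def_x def_y ->]]]]|[j [i [x [def_x lt_i ->]]]]]].
- rewrite /power_diff /parent /expo; have [def_i|neq_i] := eqVneq i (start (block i)).
    have val_i : i = block_start n (block i) :> nat by rewrite -startE -def_i.
    left; exists (block i), i, ord0; split=> //.
    (* Block 0 starts at coordinate 0, so a start other than [ord0] belongs to a later block. *)
    rewrite lt0n; apply: contra i_neq0 => /eqP bi0.
    by rewrite -val_eqE /= val_i /block_start bi0 big1.
  right; exists (block i), i, (start (block i)); split; rewrite ?startE //.
  by rewrite start_blockP //; case/andP: (blockP i).
- have def_x' : x = start j by apply: val_inj; rewrite /= startE.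
  have -> : y = ord0 by apply: val_inj.
  exists x; last by rewrite /power_diff /parent /expo def_x' block_startK eqxx.
  by rewrite -val_eqE /= def_x -lt0n block_start_gt0.
- have bi : block i = j by apply: block_eq; case/andP: lt_i => /ltnW->.
  have def_x' : x = start j by apply: val_inj; rewrite /= startE.
  have lt_xi : (x < i)%N by rewrite def_x; case/andP: lt_i.
  exists i; first by rewrite -val_eqE -lt0n (leq_ltn_trans _ lt_xi).
  rewrite /power_diff /parent /expo bi -def_x'.
  by rewrite -val_eqE /= gtn_eqF.
Qed.

Lemma torus_rowE (t : 'I_k -> K) i : block_row s.+1 n t 0 i = t (block i).
Proof. by rewrite (block_rowE _ j0) ?sum_n. Qed.

(** Two representatives of a point differ by a nonzero scalar, which can be absorbed into the
    parameters [t]. *)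
Lemma block_torusP P v : @block_torus k K s.+1 n P -> proj_coords P v ->
  exists2 t : 'I_k -> K, (forall j, t j != 0) & v = block_row s.+1 n t.
Proof.
move=> [t [t_neq0 def_P]] def_v.
have v_neq0 : v != 0.
  by have := valP P; rewrite /= def_v dim_vline; case: (v == 0).
have /vlineP[c def_c] : v \in <[block_row s.+1 n t]>%VS.
  by rewrite -def_P def_v memv_line.
have c_neq0 : c != 0.
  by apply: contra v_neq0 => /eqP c0; rewrite def_c c0 scale0r.
exists (fun j => c * t j) => [j|]; first by rewrite mulf_neq0.
by apply/rowP => i; rewrite def_c mxE !torus_rowE.
Qed.

Lemma block_torus_point (t : 'I_k -> K) : (forall j, t j != 0) ->
  exists2 P, @block_torus k K s.+1 n P & proj_coords P (block_row s.+1 n t).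
Proof.
move=> t_neq0; have dim1 : \dim <[block_row s.+1 n t]>%VS == 1%N.
  rewrite dim_vline; case: (_ =P 0) => // /rowP/(_ ord0)/eqP.
  by rewrite torus_rowE mxE (negPf (t_neq0 _)).
by exists (Sub <[block_row s.+1 n t]>%VS dim1 : proj_space K s.+1) => //; exists t.
Qed.

(** At a block start both powers equal 1, being $(q-1)$-th powers of nonzero elements; elsewhere the
    two coordinates lie in one block and coincide. *)
Lemma power_diffs_meval (t : 'I_k -> K) f : (forall j, t j != 0) ->
  ideal_gen B f -> f.@[block_row s.+1 n t 0] = 0.
Proof.
move=> t_neq0 [m [c [g [Bg ->]]]]; rewrite raddf_sum big1 // => l _ /=.
have [i i_neq0 ->] := Bg l; rewrite mevalM /power_diff mevalB.
rewrite !rmorphXn /= !mevalXU !torus_rowE /parent /expo.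
case: eqP => _; first by rewrite !expf_card_pred // subrr mulr0.
by rewrite block_startK subrr mulr0.
Qed.

Lemma power_diff_homog i : (power_diff K parent expo i) \is (expo i).-homog.
Proof.
have homogX j : ('X_j : {mpoly K[s.+1]}) ^+ expo i \is (expo i).-homog.
  by rewrite -[X in X.-homog]mul1n; apply: dhomogMn; rewrite dhomogX /= mdeg1.
by rewrite /power_diff rpredB.
Qed.

Lemma vanishing_ideal_power_diffs f :
  vanishing_ideal (@block_torus k K s.+1 n) f <-> ideal_gen B f.
Proof.
split; apply: ideal_gen_sub => {}f; last first.
  move=> Bf; apply: ideal_gen_mem; split.
    by case: Bf => i _ ->; exists (expo i); apply: power_diff_homog.
  move=> P YP v /(block_torusP YP)[t t_neq0 ->].
  exact/power_diffs_meval/ideal_gen_mem.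
case=> -[l f_hom] f_van.
have [r [r_hom r_red Ifr]] := homog_reduce parent_lt expo_gt0 f_hom.
suff r0 : r = 0 by rewrite -[f]subr0 -r0.
apply: (torus_eq0 r_hom) => [m i supp_m i_neq0|t t_neq0].
  have := r_red m i supp_m i_neq0; rewrite /expo; case: ifP => // _ lt_m.
  exact: leq_trans lt_m (card_pred_gt0 K).
(* Off the block starts the exponents in [r] are less than 1, so [r] takes the same value at [t] and
   at the block row of [u]. There both [f] and [f - r] vanish. *)
pose u j := t (start j); have u_neq0 j : u j != 0 by apply: t_neq0.
have [P YP Pu] := block_torus_point u_neq0.
have := power_diffs_meval u_neq0 Ifr; rewrite mevalB (f_van P YP _ Pu) sub0r.
move/eqP; rewrite oppr_eq0 => /eqP <-; rewrite !mevalE.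
apply: eq_big_seq => m supp_m; congr (_ * _); apply: eq_bigr => i _.
rewrite torus_rowE /u; have [<-//|neq_i] := eqVneq i (start (block i)).
have i_neq0 : i != ord0.
  by rewrite -val_eqE -lt0n (leq_ltn_trans _ (start_blockP neq_i)).
have := r_red m i supp_m i_neq0.
by rewrite /expo (negPf neq_i) ltnS leqn0 => /eqP->.
Qed.

Theorem block_torus_complete_intersection :
  complete_intersection (@block_torus k K s.+1 n) /\
  (forall f : {mpoly K[s.+1]},
     vanishing_ideal (@block_torus k K s.+1 n) f <->
     ideal_gen (fun g => W0 n g \/ exists j : 'I_k, Wblock n j g) f).
Proof.
split=> [|f].
  exists (power_diff_seq K parent expo); split=> [f|].
    by rewrite vanishing_ideal_power_diffs ideal_seq_power_diffs.
  exact: power_diff_seq_regular parent_lt expo_gt0.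
rewrite vanishing_ideal_power_diffs; apply: ideal_gen_eq; exact: power_diffs_blocks.
Qed.

End BlockTorus.

(** * Edges and degrees in the bipartite graph *)

Section BipartiteGraph.
Variables (k : nat) (e : rel 'I_k.*2).
Hypothesis e_sym : ssrbool.symmetric e.

(** Each edge has exactly one even endpoint, so edges correspond to the adjacent pairs whose first
    entry is even; these are counted by their first entry. *)
Lemma sum_deg_left_vertex : (forall x y, e x y -> odd x != odd y) ->
  (\sum_j deg e (left_vertex j))%N = #|edges e|.
Proof.
move=> e_bip; pose D := [set p | ~~ odd (val p.1) && e p.1 p.2].
have -> : edges e = [set [set p.1; p.2] | p in D].
  apply/setP => A; apply/imsetP/imsetP => [[[x y]]|[p]]; last first.
    by rewrite inE => /andP[_ ep] ->; exists p; rewrite ?inE.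
  rewrite inE /= => exy ->; have := e_bip _ _ exy; case odd_x: (odd x) => /= odd_y.
    exists (y, x); last by rewrite setUC.
    by rewrite inE /= e_sym exy andbT; case: (odd y) odd_y.
  by exists (x, y); rewrite ?inE //= odd_x.
rewrite card_in_imset => [|[x y] [x' y'] /=]; last first.
  rewrite !inE /= => /andP[even_x exy] /andP[even_x' exy'] eq_xy.
  have odd_y : odd y by have := e_bip _ _ exy; rewrite (negPf even_x); case: odd.
  have odd_y' : odd y' by have := e_bip _ _ exy'; rewrite (negPf even_x'); case: odd.
  have : x \in [set x'; y'] by rewrite -eq_xy !inE eqxx.
  have : y \in [set x'; y'] by rewrite -eq_xy !inE eqxx orbT.
  rewrite !inE => /orP[/eqP eq_y|/eqP->].
    by rewrite eq_y (negPf even_x') in odd_y.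
  by case/orP=> /eqP eq_x; [rewrite eq_x | rewrite eq_x odd_y' in even_x].
transitivity (\sum_(x : 'I_k.*2 | ~~ odd x) deg e x)%N.
  have lt_half (x : 'I_k.*2) : (x./2 < k)%N by rewrite ltn_half_double.
  rewrite [RHS](reindex_onto (@left_vertex k) (fun x => Ordinal (lt_half x))) /=.
    apply: eq_bigl => j; rewrite odd_double /=; symmetry; apply/eqP/val_inj.
    exact: doubleK.
  by move=> x even_x; apply: val_inj; rewrite /= even_halfK.
rewrite /deg -sum1_card (eq_bigr (fun x => \sum_(y | e x y) 1)%N).
  by rewrite pair_big_dep; apply: eq_bigl => p; rewrite inE.
by move=> x _; rewrite -sum1_card; apply: eq_bigl => y; rewrite inE.
Qed.

(** The matching pair at [left_vertex j] is an edge of the graph, which provides a neighbour. *)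
Lemma deg_left_vertex_gt0 j :
  perfect_matching e (@standard_matching k) -> (0 < deg e (left_vertex j))%N.
Proof.
case/andP=> /subsetP sub_e _.
have /sub_e/imsetP[[x y] /[!inE]/= exy eq_xy] :
    [set left_vertex j; right_vertex j] \in @standard_matching k.
  exact: imset_f.
have : left_vertex j \in [set x; y] by rewrite -eq_xy !inE eqxx.
rewrite !inE => /orP[]/eqP->; apply/card_gt0P; [exists y | exists x]; rewrite inE //.
by rewrite e_sym.
Qed.

End BipartiteGraph.

Theorem theorem4p1 (K : finFieldType) (k s : nat) (e : rel 'I_k.*2)
    (k_gt0 : (0 < k)%N)
    (e_sym : ssrbool.symmetric e) (e_irr : irreflexive e)
    (e_bip : forall x y, e x y -> odd x != odd y)
    (e_match : perfect_matching e (@standard_matching k))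
    (s_edges : #|edges e| = s) :
  let n := fun j : 'I_k => deg e (left_vertex j) in
  let Y := @block_torus k K s n in
  complete_intersection Y /\
  (forall f : {mpoly K[s]},
     vanishing_ideal Y f <->
     ideal_gen (fun g => W0 n g \/ exists j : 'I_k, Wblock n j g) f).
Proof.
move=> n Y; have n_gt0 j : (0 < n j)%N by apply: deg_left_vertex_gt0.
have sum_n : (\sum_j n j)%N = s by rewrite sum_deg_left_vertex.
(* The first block is nonempty, so [s] is a successor and the coordinate [ord0] exists. *)
have s_gt0 : (0 < s)%N.
  by rewrite -sum_n (bigD1 (Ordinal k_gt0)) //= addn_gt0 n_gt0.
case: s s_gt0 @Y sum_n {s_edges} => // s _ Y sum_n.
exact: block_torus_complete_intersection.
Qed.
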